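(* For all $\varepsilon \in (0,1]$, $\delta\in[0,1)$, $\alpha \geq 0$, $d\in\mathbb{N}$, all sufficiently large $T\in\mathbb{N}$, and all mechanisms $\mathcal{M}$ in the (nonadaptive) continual release model that are $(\varepsilon,\delta)$-differentially private and $(\alpha, T)$-accurate for $\mathrm{MaxSum}_d$, the following hold. (1) If $\delta > 0$ and $\delta = o(\varepsilon/T)$, then $\alpha = \Omega\Big( \min\Big\{ \frac{T^{1/3}}{\varepsilon^{2/3}\log^{2/3}( \varepsilon T)},\ \frac{\sqrt{d}}{\varepsilon \log d},\ T \Big\} \Big)$. (2) If $\delta = 0$, then $\alpha = \Omega \Big(\min\Big\{ \sqrt{T/\varepsilon},\ \frac{d}{\varepsilon},\ T \Big\} \Big)$.
   Context: Records come from $\mathcal{X}=\{0,1\}^d$; for a record $x_i$ and $j\in[d]$, $x_i[j]$ is its $j$-th coordinate. For a stream $\vec x=(x_1,\dots,x_T)$ write $\vec x_{[t]}=(x_1,\dots,x_t)$. $\mathrm{MaxSum}_d(\vec x_{[t]})=\max_{j\in[d]}\sum_{i\in[t]}x_i[j]$. Continual release model (nonadaptive): a mechanism $\mathcal{M}$ receives a stream $\vec x\in\mathcal{X}^T$ fixed in advance, one record per time step, and after receiving $x_t$ outputs an answer $a_t$. It is $(\alpha,T)$-accurate for $\mathrm{MaxSum}_d$ if for every fixed stream $\vec x\in\mathcal{X}^T$, $\Pr_{\text{coins of }\mathcal{M}}[\max_{t\in[T]}|\mathrm{MaxSum}_d(\vec x_{[t]})-a_t|\le\alpha]\ge 2/3$.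 It is $(\varepsilon,\delta)$-differentially private if the batch algorithm that maps $\vec x\in\mathcal{X}^T$ to the whole output stream $(a_1,\dots,a_T)$ is $(\varepsilon,\delta)$-DP, i.e., for all streams $\vec x,\vec x'$ differing in exactly one record and every set $S$ of outputs, $\Pr[\text{output on }\vec x\in S]\le e^\varepsilon\Pr[\text{output on }\vec x'\in S]+\delta$. *)

(* Defs.v *)
From HB Require Import structures.
From mathcomp Require Import all_boot all_order all_algebra.
From mathcomp Require Import all_classical all_reals all_analysis.

Set Implicit Arguments.
Unset Strict Implicit.
Unset Printing Implicit Defensive.

Import Order.TTheory GRing.Theory Num.Theory.
Import numFieldNormedType.Exports.

Local Open Scope classical_set_scope.
Local Open Scope ring_scope.

Definition record (d : nat) : finType := {ffun 'I_d -> bool}.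

Definition MaxSum (d : nat) (s : seq (record d)) : nat :=
  (\max_(j < d) \sum_(x <- s) x j)%N.

(* All the coins of the mechanism are drawn in advance, from the probability
   space [(Omega, P)].  [M s] is the answer given right after the last record
   of [s], when [s] is the list of all the records received so far; hence an
   answer cannot depend on future records. *)
Definition mechanism (R : realType) (d : nat) (disp : measure_display)
    (Omega : measurableType disp) (P : probability Omega R) : Type :=
  seq (record d) -> {RV P >-> R}.

(* The step [t : 'I_T] is numbered from 0: its answer follows the receipt of
   the first [t.+1] records. *)
Definition output_stream (R : realType) (d : nat) (disp : measure_display)
    (Omega : measurableType disp) (P : probability Omega R)
    (M : mechanism d P) (T : nat) (x : T.-tuple (record d)) (w : Omega) :
    T.-tuple R :=
  [tuple M (take t.+1 x) w | t < T].

Definition accurate (R : realType) (d : nat) (disp : measure_display)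
    (Omega : measurableType disp) (P : probability Omega R)
    (alpha : R) (T : nat) (M : mechanism d P) : Prop :=
  forall x : T.-tuple (record d),
    ((2 / 3)%:E <=
     P [set w | (\big[Order.max/0]_(t < T)
                   `|(MaxSum (take t.+1 x))%:R - tnth (output_stream M x w) t|
                 <= alpha)%R])%E.

Definition neighbors (d T : nat) (x x' : T.-tuple (record d)) : Prop :=
  #|[set i : 'I_T | tnth x i != tnth x' i]%SET| = 1%N.

(* [T.-tuple R] carries the product of the Borel sigma-algebras. *)
Definition differentially_private (R : realType) (d : nat)
    (disp : measure_display) (Omega : measurableType disp)
    (P : probability Omega R) (eps delta : R) (T : nat)
    (M : mechanism d P) : Prop :=
  forall x x' : T.-tuple (record d), neighbors x x' ->
  forall S : set (T.-tuple R), measurable S ->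
    (P (output_stream M x @^-1` S) <=
     (expR eps)%:E * P (output_stream M x' @^-1` S) + delta%:E)%E.

(* The logarithms of the bound occur in denominators, where [ln] vanishes for
   [d = 1] and is nonpositive for [eps * T <= 1].  Flooring the argument at 2
   keeps them positive.  It does not affect [log d] for [2 <= d], and for
   [eps * T < 2] the first term of the minimum is at least [T / 2] with either
   logarithm (if the latter is positive), so that the minimum, which also ranges
   over [T], only changes by a constant factor. *)
Definition ln_max2 (R : realType) (x : R) : R := ln (Num.max 2 x).

Definition approx_bound (R : realType) (eps : R) (d T : nat) : R :=
  Num.min (Num.min
    (T%:R `^ (1 / 3) / (eps `^ (2 / 3) * ln_max2 (eps * T%:R) `^ (2 / 3)))
    (Num.sqrt d%:R / (eps * ln_max2 d%:R)))
    T%:R.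

Definition pure_bound (R : realType) (eps : R) (d T : nat) : R :=
  Num.min (Num.min (Num.sqrt (T%:R / eps)) (d%:R / eps)) T%:R.

(* Main.v *)
(* A stream that first repeats each of n data rows k times and then, attribute by
   attribute, lets one coordinate take the lead and the others catch up, makes
   MaxSum reveal every one-way marginal of the data up to error alpha; by group
   privacy the marginals are (k eps, O(k delta))-private.

   For delta = 0, n = 1 and 2^d0 possible rows, a packing argument with
   k ~ d0 / eps gives alpha >= k / 2.

   For delta > 0, k ~ 1 / eps and a fingerprinting argument shows that n rows and
   about n^2 attributes cannot be released with error n / 72.  The columns are
   drawn from the Polya law (independent bits with a uniform bias), and row i is
   scored by the correlation of the signs of the answers with the row, centred
   given the other rows.  Accuracy makes the total score linear in the number of
   attributes, even though the answers may be adversarially wrong with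
   probability 1/3; by privacy the score of row i is about as large as if that
   row had been erased, hence at most of the order of the square root of the
   number of attributes.  This bound has no logarithmic factor, so the logarithms
   in the denominators are only used through [ln_max2 x >= 1 / 2].

   When the parameters are too small for either argument, the target is of order
   min (1 / eps, T), and six streams with disjoint all-ones blocks suffice. *)

Require Import Defs.
From HB Require Import structures.
From mathcomp Require Import all_boot all_order all_algebra.
From mathcomp Require Import all_classical all_reals all_analysis.
From mathcomp Require Import ring lra zify.

Import Order.TTheory GRing.Theory Num.Theory.
Import numFieldNormedType.Exports.

Local Open Scope classical_set_scope.
Local Open Scope ring_scope.

Set Implicit Arguments.
Unset Strict Implicit.
Unset Printing Implicit Defensive.

(** * The Polya law of a single column *)

Section PolyaColumn.
Variables (R : realFieldType) (n : nat).
Implicit Types (A : {set 'I_n}) (i : 'I_n).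

(* The law of a column of [n] independent bits whose common bias is uniform on
   [0, 1], the set [A] holding the rows that contain a one. *)
Definition polya A : R := (n.+1%:R * 'C(n, #|A|)%:R)^-1.

(* The entry of row [i] minus its conditional expectation given the others. *)
Definition innov i A : R := (i \in A)%:R - #|A :\ i|.+1%:R / n.+1%:R.

Definition lean A : R := (2 * #|A|%:R - n%:R) / n.+1%:R.

Definition toggle i A : {set 'I_n} := if i \in A then A :\ i else i |: A.

Let n1_gt0 : 0 < n.+1%:R :> R. Proof. by rewrite ltr0n. Qed.

Lemma card_le_n A : (#|A| <= n)%N.
Proof. by rewrite -[leqRHS]card_ord max_card. Qed.

Lemma polya_gt0 A : 0 < polya A.
Proof. by rewrite invr_gt0 mulr_gt0 // ltr0n bin_gt0 card_le_n. Qed.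

(** Under the Polya law the number of ones is uniform on 0, ..., n: the weight carries the inverse
    of the number of sets of each size. *)
Lemma sum_polya (f : nat -> R) :
  \sum_A polya A * f #|A| = n.+1%:R^-1 * \sum_(s < n.+1) f s.
Proof.
rewrite (partition_big (fun A => inord #|A| : 'I_n.+1) xpredT) //= mulr_sumr.
apply: eq_bigr => s _.
have Es A : (inord #|A| == s :> 'I_n.+1) = (#|A| == s :> nat).
  by rewrite -val_eqE /= inordK // ltnS card_le_n.
under eq_bigl => A do rewrite Es.
rewrite (eq_bigr (fun=> (n.+1%:R * 'C(n, s)%:R)^-1 * f s)); last first.
  by move=> A /eqP As; rewrite /polya As.
rewrite sumr_const -mulr_natl.
have -> : #|[pred A : {set 'I_n} | #|A| == s :> nat]| = 'C(n, s).
  by rewrite -[X in 'C(X, _)]card_ord -card_draws; apply: eq_card => A; rewrite !inE.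
have Cs : 'C(n, s)%:R != 0 :> R by rewrite pnatr_eq0 -lt0n bin_gt0 -ltnS.
by field; rewrite Cs nat1r pnatr_eq0.
Qed.

Lemma polya_total : \sum_A polya A = 1.
Proof.
have := sum_polya (fun=> 1); rewrite sumr_const card_ord mulVf ?gt_eqF // => <-.
by apply: eq_bigr => A _; rewrite mulr1.
Qed.

Lemma toggleK i : involutive (toggle i).
Proof.
move=> A; rewrite /toggle; case: (boolP (i \in A)) => iA.
  by rewrite setD11 finset.setD1K.
by rewrite setU11 finset.setU1K.
Qed.

Lemma toggle_erase i A : toggle i A :\ i = A :\ i.
Proof.
rewrite /toggle; case: (boolP (i \in A)) => iA.
  by apply/setP => l; rewrite !inE andbA andbb.
by apply/setP => l; rewrite !inE andb_orr andNb.
Qed.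

(** Laplace's rule of succession: given s ones in the other n - 1 rows, row [i] holds a one with
    probability (s + 1) / (n + 1). For the weights this is (s + 1) C(n, s + 1) = (n - s) C(n, s). *)
Lemma innov_mean0_notin i A : i \notin A ->
  polya A * innov i A + polya (i |: A) * innov i (i |: A) = 0.
Proof.
move=> iA; have sn : (#|A| < n)%N.
  have := card_le_n (i |: A); by rewrite cardsU1 iA.
rewrite /polya /innov finset.setU1K // (negbTE iA) setU11 cardsU1 iA /= add1n.
have -> : A :\ i = A by apply/finset.setDidPl; rewrite disjoint_sym disjoints1.
have := mul_bin_left n #|A|; move: #|A| sn => s sn E.
have {}E : s.+1%:R * 'C(n, s.+1)%:R = (n%:R - s%:R) * 'C(n, s)%:R :> R.
  by rewrite -natrB ?(ltnW sn) // -!natrM E.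
have C1 : 'C(n, s.+1)%:R != 0 :> R by rewrite pnatr_eq0 -lt0n bin_gt0.
have C0 : 'C(n, s)%:R != 0 :> R by rewrite pnatr_eq0 -lt0n bin_gt0 ltnW.
have N0 := gt_eqF n1_gt0.
apply: (mulfI (mulf_neq0 (mulf_neq0 (negbT N0) (negbT N0)) (mulf_neq0 C1 C0))).
rewrite mulr0.
transitivity (- (s.+1%:R * 'C(n, s.+1)%:R) + (n.+1%:R - s.+1%:R) * 'C(n, s)%:R :> R).
  by field; rewrite C0 C1 nat1r N0.
by rewrite E -!nat1r; ring.
Qed.

Lemma innov_mean0 i A :
  polya (toggle i A) * innov i (toggle i A) = - (polya A * innov i A).
Proof.
apply/eqP; rewrite -addr_eq0; apply/eqP.
case: (boolP (i \in A)) => iA; rewrite /toggle ?iA ?(negbTE iA).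
  have := @innov_mean0_notin i (A :\ i); rewrite finset.setD1K // setD11; exact.
by rewrite addrC; exact: innov_mean0_notin.
Qed.

Lemma cardsD1r i A : #|A :\ i|%:R = #|A|%:R - (i \in A)%:R :> R.
Proof. by rewrite [in RHS](cardsD1 i) natrD addrAC subrr add0r. Qed.

(** Links the two estimates of the total score: privacy concerns single rows, accuracy the number of
    ones in each column. *)
Lemma sum_innov A : \sum_i innov i A = lean A.
Proof.
have sumA : \sum_i (i \in A)%:R = #|A|%:R :> R.
  by rewrite -sum1_card natr_sum [RHS]big_mkcond; apply: eq_bigr => i _; case: (i \in A).
rewrite /innov sumrB sumA -mulr_suml.
rewrite (eq_bigr (fun i => (1 + #|A|%:R) - (i \in A)%:R)); last first.
  by move=> i _; rewrite -nat1r cardsD1r addrA.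
rewrite sumrB sumA sumr_const card_ord -[in LHS]mulr_natl /lean -nat1r.
by field; rewrite nat1r gt_eqF.
Qed.

Lemma innov_le1 i A : innov i A ^+ 2 <= 1.
Proof.
have p1 : #|A :\ i|.+1%:R / n.+1%:R <= 1 :> R.
  by rewrite ler_pdivrMr // mul1r ler_nat ltnS card_le_n.
have p0 : 0 <= #|A :\ i|.+1%:R / n.+1%:R :> R by rewrite divr_ge0.
rewrite -real_normK ?num_real // exprn_ile1 // ler_norml /innov.
move: (_ / _) p0 p1 => p p0 p1.
by apply/andP; split; case: (i \in A); rewrite ?mulr1n ?mulr0n; lra.
Qed.

(** The limit [m] is kept apart from [n] so that the induction leaves the centre fixed; it is
    applied with m = n. *)
Lemma sum_sqr_lean m :
  3 * \sum_(s < m.+1) (2 * s%:R - n%:R) ^+ 2 =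
  m.+1%:R * (2 * m%:R * (2 * m%:R + 1) - 6 * n%:R * m%:R + 3 * n%:R ^+ 2) :> R.
Proof.
elim: m => [|m IH]; first by rewrite big_ord_recl big_ord0 /=; ring.
by rewrite big_ord_recr /= mulrDr IH -!nat1r; ring.
Qed.

(* The bound uses |2 s - n| >= (2 s - n)^2 / n. *)
Lemma expected_abs_lean : (0 < n)%N -> 1 / 3 <= \sum_A polya A * `|lean A|.
Proof.
move=> n0.
have nR : 0 < n%:R :> R by rewrite ltr0n.
have -> : \sum_A polya A * `|lean A| =
    n.+1%:R^-1 * \sum_(s < n.+1) `|2 * s%:R - n%:R| / n.+1%:R.
  rewrite -(sum_polya (fun s => `|2 * s%:R - n%:R| / n.+1%:R)).
  by apply: eq_bigr => A _; rewrite /lean normrM [`|n.+1%:R^-1|]gtr0_norm // invr_gt0.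
have h : \sum_(s < n.+1) (2 * s%:R - n%:R) ^+ 2 / n%:R <=
    \sum_(s < n.+1) `|2 * s%:R - n%:R| :> R.
  apply: ler_sum => s _; rewrite ler_pdivrMr // -real_normK ?num_real // expr2.
  have sn : s%:R <= n%:R :> R by rewrite ler_nat -ltnS.
  have s0 : 0 <= s%:R :> R by [].
  by rewrite ler_wpM2l // ler_norml; apply/andP; split; lra.
have := sum_sqr_lean n; rewrite -mulr_suml in h; move: h.
rewrite ler_pdivrMr //.
set S2 := \sum_(s < _) _ ^+ 2; set S1 := \sum_(s < _) `|_| => h E.
rewrite -mulr_suml -/S1 -nat1r; rewrite -nat1r in E.
have n1 : 0 < 1 + n%:R :> R by rewrite nat1r.
rewrite [leRHS]mulrC -mulrA -invfM ler_pdivlMr ?mulr_gt0 //.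
rewrite -(ler_pM2r nR); apply: le_trans h.
(* The closed form gives S2 = n (n + 1) (n + 2) / 3, so the expectation is at least (n + 2) / (3 (n
   + 1)). *)
have -> : S2 = 3^-1 * (3 * S2) by field.
rewrite E -subr_ge0.
rewrite (_ : _ - _ = 3^-1 * ((1 + n%:R) * n%:R)); last by field.
by rewrite !mulr_ge0 ?invr_ge0 // ltW.
Qed.

End PolyaColumn.

(** * Fingerprinting: the scores of the rows of random data *)

Section Fingerprint.
Variables (R : realFieldType) (n d : nat).
Implicit Types (X : {ffun 'I_d -> {set 'I_n}}) (v : {ffun 'I_d -> bool}).
Implicit Types (i : 'I_n) (j : 'I_d) (A : {set 'I_n}).

Definition polya_mx X : R := \prod_j polya R (X j).

Definition erase i X : {ffun 'I_d -> {set 'I_n}} := [ffun j => X j :\ i].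

Definition toggle_mx i j X : {ffun 'I_d -> {set 'I_n}} :=
  [ffun l => if l == j then toggle i (X l) else X l].

Definition sgb (b : bool) : R := if b then 1 else -1.

Definition score i X v : R := \sum_j sgb (v j) * innov R i (X j).

Lemma polya_mx_ge0 X : 0 <= polya_mx X.
Proof. by apply: prodr_ge0 => j _; apply/ltW/polya_gt0. Qed.

Lemma polya_mx_marginal j (f : {set 'I_n} -> R) :
  \sum_X polya_mx X * f (X j) = \sum_A polya R A * f A.
Proof.
pose F l A := polya R A * (if l == j then f A else 1).
have <- : \prod_l \sum_A F l A = \sum_A polya R A * f A.
  rewrite (bigD1 j) //= [X in _ * X]big1 ?mulr1.
    by apply: eq_bigr => A _; rewrite /F eqxx.
  move=> l /negbTE lj; rewrite -[RHS](polya_total R n).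
  by apply: eq_bigr => A _; rewrite /F lj mulr1.
rewrite (bigA_distr_bigA F); apply: eq_bigr => X _.
rewrite big_split /=; congr (_ * _).
rewrite (bigD1 j) //= eqxx big1 ?mulr1 // => l /negbTE lj.
by rewrite lj.
Qed.

Lemma polya_mx_total : \sum_X polya_mx X = 1.
Proof.
rewrite /polya_mx -(bigA_distr_bigA (fun _ A => polya R A)).
by rewrite big1 // => j _; exact: polya_total.
Qed.

Lemma toggle_mxK i j : involutive (toggle_mx i j).
Proof.
move=> X; apply/ffunP => l; rewrite !ffunE; case: eqP => // _; exact: toggleK.
Qed.

Lemma erase_toggle i j X : erase i (toggle_mx i j X) = erase i X.
Proof.
by apply/ffunP => l; rewrite !ffunE; case: eqP => // _; rewrite toggle_erase.
Qed.

(** Flipping entry (i, j) fixes [h] and negates the weighted innovation, so the sum equals its own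
    opposite. *)
Lemma innov_uncorrelated i j (h : {ffun 'I_d -> {set 'I_n}} -> R) :
  (forall X, h (toggle_mx i j X) = h X) ->
  \sum_X polya_mx X * (h X * innov R i (X j)) = 0.
Proof.
move=> hh; set S := LHS.
suff E : S = - S by move: S E => S E; lra.
rewrite {1}/S (reindex_inj (inv_inj (@toggle_mxK i j))) /= -sumrN.
apply: eq_bigr => X _; rewrite hh /polya_mx (bigD1 j) //= [in RHS](bigD1 j) //=.
rewrite !ffunE eqxx.
rewrite (eq_bigr (fun l => polya R (X l))); last by move=> l /negbTE lj; rewrite ffunE lj.
have := innov_mean0 R i (X j).
move: (polya R _) (innov R i _) (polya R _) (innov R i _) => p2 y2 p1 y1 E.
move: (\prod_(_ | _) _) (h X) => p z.
transitivity (p1 * y1 * (p * z)); first by ring.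
by rewrite E; ring.
Qed.

Variable q : {ffun 'I_d -> {set 'I_n}} -> {ffun 'I_d -> bool} -> R.
Hypothesis q_ge0 : forall X v, 0 <= q X v.
Hypothesis q_total : forall X, \sum_v q X v = 1.

(* The answers to the erased data are independent of row [i], whose entries are
   independent across the columns given the other rows. *)
Lemma score_second_moment i :
  \sum_X polya_mx X * \sum_v q (erase i X) v * score i X v ^+ 2 <= d%:R.
Proof.
pose t v j l X := polya_mx X *
  ((q (erase i X) v * sgb (v j) * sgb (v l) * innov R i (X j)) * innov R i (X l)).
have -> : \sum_X polya_mx X * (\sum_v q (erase i X) v * score i X v ^+ 2) =
    \sum_v \sum_j \sum_l \sum_X t v j l X.
  under eq_bigr => X _ do rewrite mulr_sumr.
  rewrite exchange_big /=; apply: eq_bigr => v _.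
  under [RHS]eq_bigr => j _ do rewrite exchange_big /=.
  rewrite [RHS]exchange_big /=; apply: eq_bigr => X _.
  rewrite expr2 /score [X in _ * (_ * X)]mulr_suml !mulr_sumr; apply: eq_bigr => j _.
  rewrite !mulr_sumr; apply: eq_bigr => l _; rewrite /t; ring.
apply: (@le_trans _ _ (\sum_v \sum_j \sum_X polya_mx X * q (erase i X) v)).
  apply: ler_sum => v _; apply: ler_sum => j _.
  (* For l <> j, flipping entry (i, l) changes neither the erased data nor the innovation in column
     j, so the off-diagonal terms vanish. *)
  rewrite (bigD1 j) //= [X in _ + X]big1 ?addr0; last first.
    move=> l lj; apply: innov_uncorrelated => X.
    by rewrite erase_toggle ffunE eq_sym (negbTE lj).
  apply: ler_sum => X _; rewrite ler_wpM2l ?polya_mx_ge0 //.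
  have -> : q (erase i X) v * sgb (v j) * sgb (v j) * innov R i (X j) * innov R i (X j)
     = q (erase i X) v * innov R i (X j) ^+ 2.
    by rewrite /sgb; case: (v j); ring.
  by rewrite ler_piMr // innov_le1.
rewrite exchange_big /=.
under eq_bigr => j _.
  rewrite exchange_big /=.
  under eq_bigr => X _ do rewrite -mulr_sumr q_total mulr1.
  rewrite polya_mx_total; over.
by rewrite sumr_const card_ord.
Qed.

Lemma norm_score_le i X v : `|score i X v| <= d%:R.
Proof.
apply: le_trans (ler_norm_sum _ _ _) _.
rewrite -[in leRHS](card_ord d) -sumr_const; apply: ler_sum => j _.
rewrite normrM (_ : `|sgb _| = 1) ?mul1r; last first.
  by rewrite /sgb; case: (v j); rewrite ?normrN normr1.
have := innov_le1 R i (X j); rewrite -real_normK ?num_real // => h.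
by rewrite -(@expr_le1 _ 2).
Qed.

(** Here [s] stands for the square root of d, which need not exist in [R]. The second moment is
    turned into a first one by |z| <= z^2 / (2 s) + s / 2. *)
Lemma expected_norm_score i (s : R) : 0 < s -> s ^+ 2 = d%:R ->
  \sum_X polya_mx X * \sum_v q (erase i X) v * `|score i X v| <= s.
Proof.
move=> s0 sd.
have amgm (z : R) : `|z| <= (2 * s)^-1 * z ^+ 2 + s / 2.
  rewrite -(real_normK (num_real z)); move: `|z| => y.
  rewrite -subr_ge0 (_ : _ - _ = (2 * s)^-1 * (y - s) ^+ 2); last first.
    by field; rewrite gt_eqF.
  by rewrite mulr_ge0 ?sqr_ge0 // invr_ge0 ltW // mulr_gt0.
apply: (@le_trans _ _ (\sum_X polya_mx X * ((2 * s)^-1 *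
    (\sum_v q (erase i X) v * score i X v ^+ 2) + s / 2))).
  apply: ler_sum => X _; rewrite ler_wpM2l ?polya_mx_ge0 // mulr_sumr.
  have -> : s / 2 = \sum_v q (erase i X) v * (s / 2).
    by rewrite -mulr_suml q_total mul1r.
  rewrite -big_split /=.
  by apply: ler_sum => v _; rewrite mulrCA -mulrDr ler_wpM2l.
under eq_bigr => X _ do rewrite mulrDr mulrCA.
rewrite big_split /= -mulr_sumr -mulr_suml polya_mx_total mul1r.
rewrite -lerBrDr; apply: le_trans (ler_wpM2l _ (score_second_moment i)) _.
  by rewrite invr_ge0 ltW // mulr_gt0.
by rewrite -sd le_eqVlt; apply/orP; left; apply/eqP; field; rewrite gt_eqF.
Qed.

(** Let [V] be the event where the law given [X] exceeds [E] times the law given the erased data. By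
    privacy the total excess on [V] is at most [delta], and each score is at most d. *)
Lemma private_score (E delta : R) i X :
  0 <= E ->
  (forall V : pred {ffun 'I_d -> bool},
    \sum_(v | V v) q X v <= E * (\sum_(v | V v) q (erase i X) v) + delta) ->
  \sum_v q X v * score i X v <=
  E * (\sum_v q (erase i X) v * `|score i X v|) + delta * d%:R.
Proof.
move=> E0 dp; pose V v := E * q (erase i X) v < q X v.
apply: (@le_trans _ _ (\sum_v (E * (q (erase i X) v * `|score i X v|) +
    (if V v then q X v - E * q (erase i X) v else 0) * d%:R))).
  apply: ler_sum => v _.
  have Z1 : score i X v <= `|score i X v| by exact: ler_norm.
  have Zd := norm_score_le i X v; have Z0 := normr_ge0 (score i X v).
  apply: le_trans (ler_wpM2l (q_ge0 X v) Z1) _.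
  rewrite /V; case: ltP => h.
    rewrite -lerBlDl mulrA -mulrBl ler_wpM2l // subr_ge0; exact: ltW.
  by rewrite mul0r addr0 mulrA ler_wpM2r.
rewrite big_split /= -mulr_sumr lerD2l -mulr_suml ler_wpM2r //.
by rewrite -big_mkcond sumrB -mulr_sumr lerBlDl.
Qed.

Definition answers (tau : R) X v : bool :=
  [forall j, ((tau < lean R (X j)) ==> v j) && ((lean R (X j) < - tau) ==> ~~ v j)].

Lemma sum_score X v : \sum_i score i X v = \sum_j sgb (v j) * lean R (X j).
Proof.
rewrite exchange_big /=; apply: eq_bigr => j _.
by rewrite -mulr_sumr sum_innov.
Qed.

(** In a column of lean a, a good answer earns at least |a| - 2 tau, even if |a| <= tau and its sign
    is arbitrary; a bad one earns at least -|a|. Good answers having probability at least 2/3, the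
    mean is at least |a| / 3 - 2 tau. *)
Lemma accurate_score (tau : R) X : 0 <= tau ->
  2 / 3 <= \sum_(v | answers tau X v) q X v ->
  \sum_j (`|lean R (X j)| / 3 - 2 * tau) <= \sum_v q X v * \sum_i score i X v.
Proof.
move=> tau0 acc; set a := fun j => lean R (X j).
pose G := \sum_(v | answers tau X v) q X v.
have G1 : G <= 1.
  by rewrite -(q_total X) /G [leRHS](bigID (answers tau X)) /= lerDl sumr_ge0.
have bad : \sum_(v | ~~ answers tau X v) q X v = 1 - G.
  by rewrite -(q_total X) [in RHS](bigID (answers tau X)) /= addrC addrK.
apply: (@le_trans _ _ (\sum_v \sum_j q X v *
    (if answers tau X v then `|a j| - 2 * tau else - `|a j|))); last first.
  apply: ler_sum => v _; rewrite sum_score mulr_sumr; apply: ler_sum => j _.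
  rewrite ler_wpM2l // -/(a j); case: ifP => [/forallP/(_ j)|_].
    rewrite -/(a j) => /andP[/implyP h1 /implyP h2]; rewrite /sgb.
    have [t1|t1] := ltP tau (a j); first by rewrite h1 // gtr0_norm; lra.
    have [t2|t2] := ltP (a j) (- tau).
      by rewrite (negbTE (h2 _)) // ltr0_norm; lra.
    have : `|a j| <= tau by rewrite ler_norml t1 t2.
    by case: (v j) => /=; lra.
  have := ler_norm (a j); have := ler_norm (- a j); rewrite normrN /sgb.
  by case: (v j); lra.
rewrite exchange_big /=; apply: ler_sum => j _.
rewrite (bigID (answers tau X)) /=.
rewrite (eq_bigr (fun v => q X v * (`|a j| - 2 * tau))); last by move=> v ->.
rewrite [X in _ <= _ + X](eq_bigr (fun v => q X v * - `|a j|)); last first.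
  by move=> v /negbTE ->.
rewrite -!mulr_suml bad -/G -/(a j).
have y0 := normr_ge0 (a j); have gy : 0 <= (G - 2 / 3) * `|a j|.
  by rewrite mulr_ge0 // subr_ge0.
have gt : 0 <= (1 - G) * tau by rewrite mulr_ge0 // subr_ge0.
by clear -y0 gy gt; move: `|a j| y0 G gy gt => y y0 g gy gt; lra.
Qed.

(* Averages the total score of all rows in two ways: accuracy bounds it from
   below, privacy from above. *)
Lemma fingerprint (E delta tau s : R) : (0 < n)%N ->
  0 <= E -> 0 <= tau -> 0 < s -> s ^+ 2 = d%:R ->
  (forall X i (V : pred {ffun 'I_d -> bool}),
    \sum_(v | V v) q X v <= E * (\sum_(v | V v) q (erase i X) v) + delta) ->
  (forall X, 2 / 3 <= \sum_(v | answers tau X v) q X v) ->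
  d%:R * (1 / 9 - 2 * tau) <= n%:R * (E * s + delta * d%:R).
Proof.
move=> n0 E0 tau0 s0 sd dp acc.
apply: (@le_trans _ _ (\sum_X polya_mx X * \sum_v q X v * \sum_i score i X v)).
  apply: (@le_trans _ _ (\sum_X polya_mx X * \sum_j (`|lean R (X j)| / 3 - 2 * tau))).
    under [leRHS]eq_bigr => X _ do rewrite mulr_sumr.
    rewrite exchange_big /= mulr_natl -[in leLHS](card_ord d) -sumr_const.
    apply: ler_sum => j _.
    (* The 1/9 is the expected absolute lean, at least 1/3, times the factor 1/3 of
       [accurate_score]. *)
    rewrite (polya_mx_marginal j (fun A => `|lean R A| / 3 - 2 * tau)).
    under [leRHS]eq_bigr => A _ do rewrite mulrBr mulrA.
    rewrite sumrB -!mulr_suml polya_total.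
    by have := expected_abs_lean R n0; move: (\sum_A _) => y; lra.
  by apply: ler_sum => X _; rewrite ler_wpM2l ?polya_mx_ge0 // accurate_score.
under eq_bigr => X _.
  under eq_bigr => v _ do rewrite mulr_sumr.
  rewrite exchange_big /= mulr_sumr; over.
rewrite exchange_big /= [leRHS]mulr_natl -[in leRHS](card_ord n) -sumr_const.
apply: ler_sum => i _.
apply: (@le_trans _ _ (\sum_X polya_mx X *
   (E * (\sum_v q (erase i X) v * `|score i X v|) + delta * d%:R))).
  by apply: ler_sum => X _; rewrite ler_wpM2l ?polya_mx_ge0 // private_score.
under eq_bigr => X _ do rewrite mulrDr mulrCA.
rewrite big_split /= -mulr_sumr -mulr_suml polya_mx_total mul1r lerD2r.
by rewrite ler_wpM2l // expected_norm_score.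
Qed.

End Fingerprint.

(** * Decoding the output stream into bits *)

Section Decoding.
Variables (R : realType) (d : nat) (disp : measure_display).
Variables (Omega : measurableType disp) (P : probability Omega R).
Variables (M : mechanism d P) (T m : nat).
Variables (tt : 'I_m -> 'I_T) (th : 'I_m -> R).

(** Thresholding at [m] chosen steps leaves finitely many outcomes, for which privacy and accuracy
    become statements on finite sums. *)
Definition decode (a : T.-tuple R) : {ffun 'I_m -> bool} :=
  [ffun j => th j <= tnth a (tt j)].

Definition decode_prob (x : T.-tuple (record d)) (v : {ffun 'I_m -> bool}) : R :=
  fine (P (output_stream M x @^-1` [set a | decode a = v])).

(** Answers within [alpha] of the truth decode to such words; a bit is free when the true value is
    too close to its threshold. *)
Definition consistent (alpha : R) (x : T.-tuple (record d))
    (v : {ffun 'I_m -> bool}) : bool :=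
  [forall j, ((th j + alpha <= (MaxSum (take (tt j).+1 x))%:R) ==> v j) &&
             (((MaxSum (take (tt j).+1 x))%:R < th j - alpha) ==> ~~ v j)].

Lemma measurable_output_stream (x : T.-tuple (record d)) :
  measurable_fun [set: Omega] (output_stream M x).
Proof.
apply/measurable_fun_tnthP => i /=.
rewrite (_ : _ \o _ = M (take i.+1 x)); first exact: measurable_funPT.
by apply/funext => w /=; rewrite tnth_mktuple.
Qed.

Lemma measurable_decode (V : pred {ffun 'I_m -> bool}) :
  measurable [set a : T.-tuple R | V (decode a)].
Proof.
rewrite (_ : [set a | _] = \bigcup_(v in [set v | V v]) [set a | decode a = v]).
  apply: fin_bigcup_measurable => // v _.
  rewrite (_ : [set a | _] =
    \bigcap_(j in [set: 'I_m]) [set a : T.-tuple R | (th j <= tnth a (tt j)) = v j]).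
    apply: fin_bigcap_measurable => // j _.
    have mge : measurable [set a : T.-tuple R | th j <= tnth a (tt j)].
      rewrite -[X in measurable X]setTI.
      rewrite (_ : [set a | _] = (fun a : T.-tuple R => tnth a (tt j)) @^-1` `[th j, +oo[).
        by apply: measurable_tnth => //; exact: measurable_itv.
      by apply/seteqP; split => a /=; rewrite in_itv /= andbT.
    case: (v j); first exact: mge.
    rewrite (_ : [set a | _] = ~` [set a : T.-tuple R | th j <= tnth a (tt j)]).
      exact: measurableC.
    by apply/seteqP; split => a /=; [move=> -> | move/negP/negbTE].
  apply/seteqP; split => a /=.
    by move=> <- j _ /=; rewrite ffunE.
  by move=> av; apply/ffunP => j; rewrite ffunE av.
apply/seteqP; split => a /=; first by move=> Va; exists (decode a).
by case=> v /= Vv ->.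
Qed.

Lemma decode_prob_ge0 x v : 0 <= decode_prob x v.
Proof. exact/fine_ge0/measure_ge0. Qed.

Lemma decode_prob_sum x (V : pred {ffun 'I_m -> bool}) :
  (\sum_(v | V v) decode_prob x v)%:E =
  P (output_stream M x @^-1` [set a | V (decode a)]).
Proof.
have mE v : measurable (output_stream M x @^-1` [set a | decode a = v]).
  rewrite -[X in measurable X]setTI; apply: measurable_output_stream => //.
  rewrite (_ : [set a | _] = [set a | pred1 v (decode a)]).
    exact: measurable_decode.
  by apply/seteqP; split => a /= /eqP.
rewrite (_ : _ @^-1` _ = \bigcup_(v in [set` enum V])
    (output_stream M x @^-1` [set a | decode a = v])); last first.
  apply/seteqP; split => w /=.
    by move=> Vw; exists (decode (output_stream M x w)) => //=; rewrite mem_enum.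
  by case=> v /=; rewrite mem_enum => Vv ->.
rewrite measure_fin_bigcup //=; last first.
- move=> v v' _ _ [w [/= <- <-]] //.
rewrite -fsbig_seq ?enum_uniq //= big_enum_cond /= -sumEFin.
apply: eq_big => v; first by rewrite andbT.
by move=> _; rewrite fineK // fin_num_measure.
Qed.

Lemma decode_prob_total x : \sum_v decode_prob x v = 1.
Proof.
apply: EFin_inj; rewrite (decode_prob_sum x xpredT) -(@probability_setT _ _ _ P).
by congr (P _); apply/seteqP; split.
Qed.

Lemma decode_prob_private (eps delta : R) x x' (V : pred {ffun 'I_m -> bool}) :
  differentially_private eps delta T M -> neighbors x x' ->
  \sum_(v | V v) decode_prob x v <=
  expR eps * (\sum_(v | V v) decode_prob x' v) + delta.
Proof.
move=> dp xx'; rewrite -lee_fin EFinD EFinM !decode_prob_sum.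
exact: (dp _ _ xx' _ (measurable_decode V)).
Qed.

Lemma decode_prob_accurate (alpha : R) x : accurate alpha T M ->
  2 / 3 <= \sum_(v | consistent alpha x v) decode_prob x v.
Proof.
move=> acc; rewrite -lee_fin decode_prob_sum.
apply: le_trans (acc x) _; apply: le_measure; rewrite ?inE.
(* The maximum starts from 0, so the event also contains the condition [0 <= alpha]. *)
- rewrite (_ : [set w | _] = [set _ | 0 <= alpha] `&` \bigcap_(t in [set: 'I_T])
     (M (take t.+1 x) @^-1` `[(MaxSum (take t.+1 x))%:R - alpha,
                              (MaxSum (take t.+1 x))%:R + alpha])).
    apply: measurableI.
      by case: (boolP (0 <= alpha)) => h;
        [rewrite (_ : [set _ | _] = setT) | rewrite (_ : [set _ | _] = set0)] => //;
        apply/seteqP; split.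
    apply: fin_bigcap_measurable => // t _.
    exact: measurable_funPTI.
  apply/seteqP; split => w /=.
    move=> /bigmax_leP[a0 h]; split => // t _ /=.
    by have := h t isT; rewrite tnth_mktuple in_itv /= ler_distlC.
  case=> a0 h; apply/bigmax_leP; split => // t _.
  by have := h t I; rewrite tnth_mktuple /= in_itv /= ler_distlC.
- rewrite -[X in measurable X]setTI; apply: measurable_output_stream => //.
  exact: measurable_decode.
- move=> w /= werr; apply/forallP => j.
  have : `|(MaxSum (take (tt j).+1 x))%:R - tnth (output_stream M x w) (tt j)| <= alpha.
    apply: le_trans werr.
    exact: (@le_bigmax _ _ _ (0 : R) (fun t : 'I_T =>
    `|(MaxSum (take t.+1 x))%:R - tnth (output_stream M x w) t|)).
  rewrite ler_distl => /andP[lo hi]; rewrite ffunE.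
  apply/andP; split; apply/implyP => h; first by lra.
  by rewrite -ltNge; lra.
Qed.

End Decoding.

(** * Group privacy and packing *)

Definition differ (T : nat) (A : eqType) (x x' : T.-tuple A) : {set 'I_T} :=
  [set i : 'I_T | tnth x i != tnth x' i]%SET.

(** One record is changed at a time; the geometric sum of the additive losses is relaxed to h E^h
    delta. *)
Lemma group_privacy (R : realType) (d T h : nat) (E delta : R)
    (f : T.-tuple (record d) -> R) :
  1 <= E -> 0 <= delta -> (forall x, 0 <= f x) ->
  (forall x x', neighbors x x' -> f x <= E * f x' + delta) ->
  forall x x', (#|differ x x'| <= h)%N ->
  f x <= E ^+ h * (f x' + h%:R * delta).
Proof.
move=> E1 delta0 f0 fdp; elim: h => [|h IH] x x' hxx'.
  rewrite expr0 mul1r mul0r addr0.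
  suff -> : x = x' by [].
  apply: eq_from_tnth => i; apply/eqP/negPn/negP => xi.
  move: hxx'; rewrite leqn0 cards_eq0 => /eqP/setP/(_ i).
  by rewrite !inE xi.
have E0 : 0 <= E by lra.
have [xx'|[i ixx']] := set_0Vmem (differ x x').
  apply: le_trans (IH x x' _) _; first by rewrite xx' cards0.
  apply: ler_pM; [exact: exprn_ge0 | by rewrite addr_ge0 ?mulr_ge0 | |].
    by rewrite exprS ler_peMl ?exprn_ge0.
  by rewrite lerD2l ler_wpM2r // ler_nat.
pose y := [tuple if t == i then tnth x' t else tnth x t | t < T].
have xy : neighbors x y.
  rewrite /neighbors -(cards1 i); congr #|pred_of_set _|; apply/setP => t.
  rewrite !inE tnth_mktuple; case: (eqVneq t i) => [->|_]; last by rewrite eqxx.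
  by move: ixx'; rewrite inE => ->.
have yx' : (#|differ y x'| <= h)%N.
  rewrite -ltnS; apply: leq_trans hxx'; apply: proper_card.
  apply/properP; split; last by exists i; rewrite // !inE tnth_mktuple !eqxx.
  apply/fintype.subsetP => t; rewrite !inE tnth_mktuple.
  by case: (eqVneq t i) => [->|//]; rewrite eqxx.
apply: le_trans (fdp _ _ xy) _.
have := ler_wpM2l E0 (IH _ _ yx') => IHy.
apply: le_trans (lerD IHy (lexx _)) _.
rewrite exprS mulrA -[in X in _ <= X]natr1 [(h%:R + 1) * _]mulrDl mul1r addrA [in X in _ <= X]mulrDr.
by rewrite lerD2l ler_peMl // -exprS exprn_ege1.
Qed.

Lemma decode_prob_group (R : realType) (d : nat) (disp : measure_display)
    (Omega : measurableType disp) (P : probability Omega R)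
    (M : mechanism d P) (T m : nat) (tt : 'I_m -> 'I_T) (th : 'I_m -> R)
    (eps delta : R) (h : nat) x x' (V : pred {ffun 'I_m -> bool}) :
  0 <= eps -> 0 <= delta -> differentially_private eps delta T M ->
  (#|differ x x'| <= h)%N ->
  \sum_(v | V v) decode_prob M tt th x v <=
  expR (h%:R * eps) * (\sum_(v | V v) decode_prob M tt th x' v + h%:R * delta).
Proof.
move=> eps0 delta0 dp; rewrite expRM_natl.
apply: (@group_privacy _ _ _ _ _ _ (fun x => \sum_(v | V v) decode_prob M tt th x v)) => //.
- by rewrite -expR0 ler_expR.
- by move=> y; apply: sumr_ge0 => v _; exact: decode_prob_ge0.
- by move=> y y' yy'; exact: decode_prob_private.
Qed.

(** Each stream puts mass 2/3 on its own consistent words; group privacy transfers these masses to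
    [x0], where the disjoint sets of words have total mass at most 1. *)
Lemma packing (R : realType) (d : nat) (disp : measure_display)
    (Omega : measurableType disp) (P : probability Omega R)
    (M : mechanism d P) (T m : nat) (tt : 'I_m -> 'I_T) (th : 'I_m -> R)
    (eps delta alpha : R) (h : nat) (B : finType)
    (x0 : T.-tuple (record d)) (x : B -> T.-tuple (record d)) :
  0 <= eps -> 0 <= delta ->
  differentially_private eps delta T M -> accurate alpha T M ->
  (forall b, #|differ (x b) x0| <= h)%N ->
  (forall b b' v, consistent tt th alpha (x b) v ->
                  consistent tt th alpha (x b') v -> b = b') ->
  #|B|%:R * (2 / 3) <= expR (h%:R * eps) * (1 + #|B|%:R * (h%:R * delta)).
Proof.
move=> eps0 delta0 dp acc xh xinj.
pose p := decode_prob M tt th; pose C b := consistent tt th alpha (x b).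
have -> : #|B|%:R * (2 / 3) = \sum_(b : B) (2 / 3) :> R.
  by rewrite sumr_const mulr_natl.
apply: (@le_trans _ _ (\sum_b \sum_(v | C b v) p (x b) v)).
  by apply: ler_sum => b _; exact: decode_prob_accurate.
apply: (@le_trans _ _
    (\sum_b expR (h%:R * eps) * (\sum_(v | C b v) p x0 v + h%:R * delta))).
  by apply: ler_sum => b _; exact: decode_prob_group.
rewrite -mulr_sumr ler_wpM2l ?expR_ge0 // big_split /= sumr_const -[X in _ + X <= _]mulr_natl lerD2r.
rewrite (exchange_big_dep xpredT) //= -(decode_prob_total M tt th x0).
apply: ler_sum => v _.
case: (pickP (fun b => C b v)) => [b Cb|C0]; last first.
  by rewrite big_pred0 // decode_prob_ge0.
by rewrite (big_pred1 b) // => b'; apply/idP/eqP => [Cb'|->//]; apply: xinj Cb' Cb.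
Qed.

(** * Streams given by functions of time *)

Definition stream (d T : nat) (F : nat -> record d) : T.-tuple (record d) :=
  [tuple F t | t < T].

Lemma sum_take_stream (d T tau : nat) (F : nat -> record d) (j : 'I_d) :
  (tau <= T)%N ->
  (\sum_(r <- take tau (stream T F)) r j = \sum_(0 <= t < tau) F t j)%N.
Proof.
move=> tauT; rewrite /stream /= -[take _ _]/(take tau (map _ (enum 'I_T))).
rewrite (map_comp F val) val_enum_ord -map_take take_iota (minn_idPl tauT).
by rewrite big_map /index_iota subn0.
Qed.

Lemma MaxSum_stream (d T tau S : nat) (F : nat -> record d) (j0 : 'I_d) :
  (tau <= T)%N -> (\sum_(0 <= t < tau) F t j0 = S)%N ->
  (forall j, \sum_(0 <= t < tau) F t j <= S)%N ->
  MaxSum (take tau (stream T F)) = S.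
Proof.
move=> tauT Fj0 FS; apply/eqP; rewrite eqn_leq /MaxSum; apply/andP; split.
  by apply/bigmax_leqP => j _; rewrite sum_take_stream.
by rewrite -Fj0 -(@sum_take_stream d T) //; exact: leq_bigmax.
Qed.

Lemma differ_stream (d T n : nat) (F F' : nat -> record d) (a : nat) :
  (forall t, F t != F' t -> a <= t < a + n)%N ->
  (#|differ (stream T F) (stream T F')| <= n)%N.
Proof.
move=> FF'.
have sub (t : 'I_T) : t \in differ (stream T F) (stream T F') -> (a <= t < a + n)%N.
  by rewrite inE !tnth_mktuple; exact: FF'.
rewrite cardE -(size_map val) -(size_iota a n); apply: uniq_leq_size.
  by rewrite map_inj_uniq ?enum_uniq //; exact: val_inj.
by move=> s /mapP[t]; rewrite mem_enum => /sub ht ->; rewrite mem_iota.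
Qed.

Lemma times_exist (m T : nat) (tau : 'I_m -> nat) :
  (forall j, 0 < tau j <= T)%N -> exists tt : 'I_m -> 'I_T, forall j, (tt j).+1 = tau j.
Proof.
move=> tauT.
have lt j : ((tau j).-1 < T)%N by case/andP: (tauT j) => t0 tT; rewrite prednK.
by exists (fun j => Ordinal (lt j)) => j /=; rewrite prednK //; case/andP: (tauT j).
Qed.

(** * The bound from six disjoint blocks *)

Lemma expR1_lt3 (R : realType) : expR 1 < 3 :> R.
Proof.
(* Sixths are fine enough: (6/5)^6 < 3, whereas (5/4)^5 > 3. *)
have : 1 - 6^-1 <= expR (- 6^-1) :> R by exact: expR_ge1Dx.
rewrite expRN => h.
have e0 : 0 < expR (6^-1 : R) by exact: expR_gt0.
have {}h : expR (6^-1 : R) <= 6 / 5.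
  rewrite -[leLHS]invrK -[leRHS]invrK lef_pV2 ?posrE ?invr_gt0 //; lra.
have -> : expR 1 = expR (6^-1 : R) ^+ 6 by rewrite -expRM_natl mulfV.
apply: (@le_lt_trans _ _ ((6 / 5) ^+ 6)); last by lra.
by apply: lerXn2r => //; rewrite nnegrE; lra.
Qed.

(** Stream b has its ones in the b-th block of [k] records. If alpha < k / 2, the answers at the
    block ends reveal b, and packing yields 6 * (2/3) = 4 <= 3 (1 + 6/50), which is false. *)
Lemma accuracy_ge_block (R : realType) (d : nat) (disp : measure_display)
    (Omega : measurableType disp) (P : probability Omega R)
    (M : mechanism d P) (T k : nat) (eps delta alpha : R) :
  (0 < d)%N -> (0 < k)%N -> (6 * k <= T)%N -> 0 <= eps -> 0 <= delta ->
  k%:R * eps <= 1 -> k%:R * delta <= 1 / 50 ->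
  differentially_private eps delta T M -> accurate alpha T M ->
  k%:R / 2 <= alpha.
Proof.
move=> d0 k0 kT eps0 delta0 keps kdelta dp acc; rewrite leNgt; apply/negP => small.
pose F (b : 'I_6) t : record d := [ffun _ => (t %/ k)%N == b].
have sumF b c (j : 'I_d) : (\sum_(0 <= t < c * k) F b t j = k * (b < c))%N.
  elim: c => [|c IH]; first by rewrite mul0n big_nil muln0.
  rewrite (@big_cat_nat _ _ _ (c * k)) //= ?leq_mul2r ?leqnSn ?orbT // IH.
  rewrite (@eq_big_nat _ _ _ _ _ _ (fun=> nat_of_bool (c == b))).
    by rewrite sum_nat_const_nat -mulnBl subSn // subnn mul1n -mulnDr; lia.
  move=> t /andP[ct tc]; rewrite ffunE; congr (nat_of_bool (_ == _)).
  by apply/eqP; rewrite eqn_leq -ltnS ltn_divLR // tc leq_divRL.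
have MS b c : (c <= 6)%N -> MaxSum (take (c * k) (stream T (F b))) = (k * (b < c))%N.
  move=> c6; apply: (MaxSum_stream (j0 := Ordinal d0)) => [||j]; rewrite ?sumF //.
  by apply: leq_trans kT; rewrite leq_mul2r c6 orbT.
have [j|tt ttE] := @times_exist 6 T (fun j => j.+1 * k)%N.
  rewrite muln_gt0 k0 /=; apply: leq_trans kT; rewrite leq_mul2r; apply/orP; right.
  exact: ltn_ord.
have cons b v : consistent tt (fun=> k%:R / 2) alpha (stream T (F b)) v ->
    forall c, v c = (b <= c)%N.
  move=> /forallP h c; have {h} := h c; rewrite ttE MS ?ltn_ord // ltnS.
  case: (b <= c)%N; rewrite ?muln1 ?muln0 => /andP[/implyP h1 /implyP h2].
    by apply: h1; lra.
  by apply/negbTE/h2; lra.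
pose zero := stream T (fun=> [ffun=> false] : record d).
have dist b : (#|differ (stream T (F b)) zero| <= k)%N.
  apply: (@differ_stream _ _ _ _ _ (b * k)%N) => t tb.
  have /eqP tkb : (t %/ k)%N == b.
    apply: contraNT tb => /negbTE tb.
    by apply/eqP/ffunP => j; rewrite !ffunE tb.
  by rewrite -mulSnr -leq_divRL // -ltn_divLR // tkb leqnn ltnSn.
have inj b b' v : consistent tt (fun=> k%:R / 2) alpha (stream T (F b)) v ->
    consistent tt (fun=> k%:R / 2) alpha (stream T (F b')) v -> b = b'.
  move=> vb vb'; apply/val_inj/eqP; rewrite eqn_leq.
  by rewrite -(cons _ _ vb) (cons _ _ vb') leqnn -(cons _ _ vb') (cons _ _ vb) leqnn.
have := packing eps0 delta0 dp acc dist inj; rewrite card_ord => h.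
have e3 : expR (k%:R * eps) <= 3.
  by rewrite (le_trans _ (ltW (expR1_lt3 R))) // ler_expR.
have kd0 : 0 <= k%:R * delta by rewrite mulr_ge0.
have := ler_wpM2r (ltac:(lra) : 0 <= 1 + 6 * (k%:R * delta)) e3.
lra.
Qed.

(** * Streams that reveal all marginals *)

(* The first [n * k] records repeat each of the [n] data rows [k] times.  Then,
   with [m = n * k], the [q]-th block of [2 * m] records first gives coordinate
   [q] a lead of [m], so that it attains the maximum, and then lets the other
   coordinates catch up. *)
Definition marginal_stream (d n k : nat) (D : nat -> nat -> bool) (t : nat) :
    record d :=
  [ffun j : 'I_d => if (t < n * k)%N then D (t %/ k)%N j
    else let u := (t - n * k)%N in
         (u %% (2 * (n * k)) < n * k)%N == (u %/ (2 * (n * k)) == j)%N].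

(** The end of the first half of block [q], where coordinate [q] has its full lead. *)
Definition marginal_time (n k q : nat) : nat := (n * k + (2 * q + 1) * (n * k))%N.

Lemma sum_marginal_stream (d n k : nat) (D : nat -> nat -> bool) (q : nat)
    (j : 'I_d) : (0 < k)%N ->
  (\sum_(0 <= t < marginal_time n k q) marginal_stream d n k D t j =
   (q + (q == j)) * (n * k) + k * \sum_(0 <= i < n) D i j)%N.
Proof.
move=> k0; rewrite /marginal_time; set m := (n * k)%N.
rewrite (@big_cat_nat _ _ _ m) ?leq_addr //= addnC; congr (_ + _)%N; last first.
  rewrite (@eq_big_nat _ _ _ _ _ _ (fun t => nat_of_bool (D (t %/ k)%N j))); last first.
    by move=> t /andP[_ tm]; rewrite ffunE tm.
  rewrite /m {m}; elim: n => [|n' IH]; first by rewrite mul0n !big_nil muln0.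
  rewrite (@big_cat_nat _ _ _ (n' * k)) //= ?leq_mul2r ?leqnSn ?orbT // IH.
  rewrite big_nat_recr //= mulnDr; congr (_ + _)%N.
  rewrite (@eq_big_nat _ _ _ _ _ _ (fun=> nat_of_bool (D n' j))).
    by rewrite sum_nat_const_nat -mulnBl subSn // subnn mul1n.
  move=> t /andP[ct tc]; congr (nat_of_bool (D _ j)).
  by apply/eqP; rewrite eqn_leq -ltnS ltn_divLR // tc leq_divRL.
have [->|m0] := posnP m; first by rewrite !muln0 big_geq.
pose G (u : nat) := nat_of_bool ((u %% (2 * m) < m)%N == (u %/ (2 * m) == j)%N).
rewrite -{1}[m]add0n big_addn addKn.
rewrite (@eq_big_nat _ _ _ _ _ _ G); last first.
  by move=> u _; rewrite ffunE ltnNge leq_addl /= addnK.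
have m2 : (0 < 2 * m)%N by lia.
have lead c : (\sum_(2 * c * m <= u < (2 * c + 1) * m) G u = (c == j) * m)%N.
  rewrite (@eq_big_nat _ _ _ _ _ _ (fun=> nat_of_bool (c == j))).
    by rewrite sum_nat_const_nat; nia.
  move=> u /andP[cu uc]; rewrite /G.
  have [w -> wm] : exists2 w, u = (c * (2 * m) + w)%N & (w < m)%N.
    by exists (u - 2 * c * m)%N; nia.
  have w2 : (w < 2 * m)%N by lia.
  rewrite modnMDl (modn_small w2) (divnMDl _ _ m2) (divn_small w2) addn0 wm.
  by case: (c == j).
have catchup c : (\sum_((2 * c + 1) * m <= u < 2 * c.+1 * m) G u = (c != j) * m)%N.
  rewrite (@eq_big_nat _ _ _ _ _ _ (fun=> nat_of_bool (c != j))).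
    by rewrite sum_nat_const_nat; nia.
  move=> u /andP[cu uc]; rewrite /G.
  have [w -> /andP[mw wm]] : exists2 w, u = (c * (2 * m) + w)%N & (m <= w < 2 * m)%N.
    by exists (u - 2 * c * m)%N; nia.
  rewrite modnMDl (modn_small wm) (divnMDl _ _ m2) (divn_small wm) addn0.
  by rewrite ltnNge mw; case: (c == j).
(* A complete block adds m to every coordinate, so leads do not accumulate. *)
have full c : (\sum_(0 <= u < 2 * c * m) G u = c * m)%N.
  elim: c => [|c IH]; first by rewrite muln0 mul0n big_nil.
  rewrite (@big_cat_nat _ _ _ (2 * c * m)) //=; last by nia.
  rewrite IH (@big_cat_nat _ _ _ ((2 * c + 1) * m)) //=; [|nia|nia].
  by rewrite lead catchup; case: (c == j) => /=; nia.
rewrite (@big_cat_nat _ _ _ (2 * q * m)) //=; last by nia.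
by rewrite full lead mulnDl.
Qed.

(** The data contribute at most n k to any coordinate, so a lead of n k makes [q] a maximiser
    whatever the data. *)
Lemma MaxSum_marginal_stream (d n k T : nat) (D : nat -> nat -> bool) (q : 'I_d) :
  (0 < k)%N -> (marginal_time n k q <= T)%N ->
  MaxSum (take (marginal_time n k q) (stream T (marginal_stream d n k D))) =
  (q.+1 * (n * k) + k * \sum_(0 <= i < n) D i q)%N.
Proof.
move=> k0 tT; apply: (MaxSum_stream (j0 := q)) => // [|j]; rewrite sum_marginal_stream //.
  by rewrite eqxx addn1.
case: eqP => [/val_inj <-|_]; first by rewrite addn1.
rewrite addn0 mulSnr -addnA leq_add2l; apply: leq_trans (leq_addr _ _).
rewrite [leqRHS]mulnC leq_mul2l; apply/orP; right.
rewrite -[leqRHS]muln1 -[X in (_ <= X * 1)%N]subn0 -sum_nat_const_nat.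
by apply: leq_sum => i _; exact: leq_b1.
Qed.

Section Marginals.
Variables (R : realType) (d d0 n k T : nat).
Hypotheses (n_gt0 : (0 < n)%N) (k_gt0 : (0 < k)%N) (d0d : (d0 <= d)%N).
Hypothesis T_ge : (2 * d0 * (n * k) <= T)%N.
Implicit Types (X : {ffun 'I_d0 -> {set 'I_n}}).

(** The attributes from [d0] on are padded with zeros in the data part. *)
Definition data_stream X : T.-tuple (record d) :=
  stream T (marginal_stream d n k (fun i j =>
    oapp (fun j' : 'I_d0 => oapp (fun i' : 'I_n => i' \in X j') false (insub i))
      false (insub j))).

(** The known contribution of the blocks, plus half of the largest possible contribution of the
    data. *)
Definition marginal_threshold (q : 'I_d0) : R :=
  (q.+1 * (n * k))%:R + (n * k)%:R / 2.

Lemma marginal_times :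
  exists tt : 'I_d0 -> 'I_T, forall q, (tt q).+1 = marginal_time n k q.
Proof.
clear d0d.
apply: times_exist => q; rewrite /marginal_time.
have nk : (0 < n * k)%N by rewrite muln_gt0 n_gt0.
apply/andP; split; first by lia.
(* The last time, for q = d0 - 1, is exactly 2 d0 n k. *)
by apply: leq_trans T_ge; have := ltn_ord q; nia.
Qed.

Lemma consistent_marginals (tt : 'I_d0 -> 'I_T) (alpha : R) X v q :
  (forall q, (tt q).+1 = marginal_time n k q) ->
  consistent tt marginal_threshold alpha (data_stream X) v ->
  ((n * k)%:R / 2 + alpha <= k%:R * #|X q|%:R -> v q) /\
  (k%:R * #|X q|%:R < (n * k)%:R / 2 - alpha -> ~~ v q).
Proof.
move=> ttE /forallP/(_ q); rewrite ttE -[q in marginal_time _ _ q]/(val (widen_ord d0d q)).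
rewrite MaxSum_marginal_stream //; last by rewrite -ttE.
rewrite big_mkord (eq_bigr (fun i => nat_of_bool (i \in X q))); last first.
  by move=> i _; rewrite /= !valK.
rewrite (_ : (\sum_(i < n) (i \in X q) = #|X q|)%N); last first.
  by rewrite -sum1_card [RHS]big_mkcond; apply: eq_bigr => i _; case: (i \in X q).
rewrite /marginal_threshold natrD [(k * _)%:R]natrM -addrA lerD2l -addrA ltrD2l /=.
by move=> /andP[/implyP h1 /implyP h2].
Qed.

Lemma differ_erase i X : (#|differ (data_stream X) (data_stream (erase i X))| <= k)%N.
Proof.
apply: (@differ_stream _ _ _ _ _ (i * k)%N) => t.
apply: contraNT => ti; apply/eqP/ffunP => j; rewrite !ffunE.
case: ifP => // tn; case: insubP => [i' _ i't|_]; case: insubP => //= j' _ _.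
rewrite ffunE !inE; case: eqP => //= ii'; case/negP: ti.
by rewrite -mulSnr -leq_divRL // -ltn_divLR // -i't ii' leqnn ltnSn.
Qed.

Lemma differ_data X X' : (#|differ (data_stream X) (data_stream X')| <= n * k)%N.
Proof.
apply: (@differ_stream _ _ _ _ _ 0%N) => t; rewrite add0n /=.
by apply: contraNT => /negbTE tn; apply/eqP/ffunP => j; rewrite !ffunE tn.
Qed.

End Marginals.

(** * Error bounds from packing and from fingerprinting *)

Lemma pure_accuracy_ge (R : realType) (d : nat) (disp : measure_display)
    (Omega : measurableType disp) (P : probability Omega R)
    (M : mechanism d P) (T d0 k : nat) (eps alpha : R) :
  (0 < d0 <= d)%N -> (0 < k)%N -> (2 * d0 * k <= T)%N -> 0 <= eps ->
  k%:R * eps <= d0%:R / 4 ->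
  differentially_private eps 0 T M -> accurate alpha T M ->
  k%:R / 2 <= alpha.
Proof.
move=> /andP[d00 d0d] k0 kT eps0 keps dp acc; rewrite leNgt; apply/negP => small.
have n0 : (0 < 1)%N by [].
have kT1 : (2 * d0 * (1 * k) <= T)%N by rewrite mul1n.
have [tt ttE] := marginal_times n0 k0 kT1.
pose X0 : {ffun 'I_d0 -> {set 'I_1}} := [ffun=> finset.set0].
(* With a single row each marginal counts 0 or k, so an error below k / 2 recovers every bit. *)
have cons (X : {ffun 'I_d0 -> {set 'I_1}}) v :
    consistent tt (marginal_threshold R 1 k) alpha (data_stream d k T X) v ->
    forall q, v q = (ord0 \in X q).
  move=> h q; have {h}[h1 h2] := consistent_marginals k0 d0d q ttE h.
  move: h1 h2; rewrite mul1n (cardsD1 ord0).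
  have -> : X q :\ ord0 = finset.set0 by apply/setP => i; rewrite !inE ord1 eqxx.
  rewrite cards0 addn0; case: (ord0 \in X q); rewrite ?mulr1 ?mulr0 => h1 h2.
    by apply: h1; lra.
  by apply/negbTE/h2; lra.
have inj (X X' : {ffun 'I_d0 -> {set 'I_1}}) v :
    consistent tt (marginal_threshold R 1 k) alpha (data_stream d k T X) v ->
    consistent tt (marginal_threshold R 1 k) alpha (data_stream d k T X') v ->
    X = X'.
  move=> Xv X'v; apply/ffunP => q; apply/setP => i.
  by rewrite ord1 -(cons _ _ Xv) (cons _ _ X'v).
have dist (X : {ffun 'I_d0 -> {set 'I_1}}) :
    (#|differ (data_stream d k T X) (data_stream d k T X0)| <= k)%N.
  by rewrite -[leqRHS]mul1n differ_data.
have := packing eps0 (lexx 0) dp acc dist inj.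
rewrite !mulr0 addr0 mulr1 card_ffun card_ord.
have -> : #|{set 'I_1}| = 2%N by rewrite -cardsT -powersetT card_powerset cardsT card_ord.
rewrite leNgt => /negP; apply.
(* Packing gave 2^d0 * (2/3) <= e^(k eps) <= e^(d0 / 4). This fails since e^(1/4) < 4/3 and 2 =
   (4/3) (3/2), one factor 3/2 absorbing the 2/3. *)
have e4 : expR (4^-1 : R) < 4 / 3.
  have : 1 - 4^-1 < expR (- 4^-1) :> R by apply: expR_gt1Dx; rewrite oppr_eq0 invr_eq0.
  rewrite expRN => h; rewrite -[ltLHS]invrK -[ltRHS]invrK ltf_pV2 ?posrE ?invr_gt0 ?expR_gt0 //; lra.
apply: (@le_lt_trans _ _ (expR (4^-1 : R) ^+ d0)).
  by rewrite -expRM_natl ler_expR.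
apply: (@lt_le_trans _ _ ((4 / 3) ^+ d0)).
  by rewrite ltrXn2r // ?nnegrE ?expR_ge0 // -lt0n.
have -> : (2 ^ d0)%:R = (4 / 3) ^+ d0 * (3 / 2) ^+ d0 :> R.
  by rewrite natrX -exprMn; congr (_ ^+ _); field.
rewrite -mulrA; apply: ler_peMr; first by rewrite exprn_ge0 //; lra.
have -> : d0 = d0.-1.+1 by rewrite prednK.
rewrite exprS mulrAC (_ : 3 / 2 * (2 / 3) = 1 :> R) ?mul1r; last by field.
by rewrite exprn_ege1 //; lra.
Qed.

Lemma approx_accuracy_ge (R : realType) (d : nat) (disp : measure_display)
    (Omega : measurableType disp) (P : probability Omega R)
    (M : mechanism d P) (T n k : nat) (eps delta alpha : R) :
  (0 < n)%N -> (0 < k)%N -> ((216 * n) ^ 2 <= d)%N ->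
  (2 * (216 * n) ^ 2 * (n * k) <= T)%N -> 0 <= eps -> 0 <= delta ->
  k%:R * eps <= 1 -> n%:R * k%:R * delta <= 1 / 100 ->
  differentially_private eps delta T M -> accurate alpha T M ->
  n%:R * k%:R / 72 <= alpha.
Proof.
move=> n0 k0 d0d kT eps0 delta0 keps nkd dp acc; rewrite leNgt; apply/negP => small.
have [tt ttE] := marginal_times n0 k0 kT.
set d0 := ((216 * n) ^ 2)%N in d0d kT tt ttE.
pose q (X : {ffun 'I_d0 -> {set 'I_n}}) :=
  decode_prob M tt (marginal_threshold R n k) (data_stream d k T X).
have nR : 0 < n%:R :> R by rewrite ltr0n.
have kR : 0 < k%:R :> R by rewrite ltr0n.
(* A lean beyond 1/36 moves k x away from n k / 2 by more than n k / 72, hence by more than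
   [alpha]. *)
have up (x : R) : 1 / 36 * (1 + n%:R) < 2 * x - n%:R ->
    n%:R * k%:R / 2 + alpha <= k%:R * x.
  by rewrite -(ltr_pM2l kR); lra.
have down (x : R) : 2 * x - n%:R < - (1 / 36) * (1 + n%:R) ->
    k%:R * x < n%:R * k%:R / 2 - alpha.
  by rewrite -(ltr_pM2l kR); lra.
have acc' X : 2 / 3 <= \sum_(v | answers (1 / 36 : R) X v) q X v.
  apply: le_trans (decode_prob_accurate tt (marginal_threshold R n k) (data_stream d k T X) acc) _.
  rewrite big_mkcond [leRHS]big_mkcond; apply: ler_sum => v _.
  case: ifP => cv; last by case: ifP => // _; exact: decode_prob_ge0.
  rewrite ifT //.
  apply/forallP => j; have [h1 h2] := consistent_marginals k0 d0d j ttE cv.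
  rewrite natrM in h1 h2; rewrite /lean ltr_pdivlMr ?ltr0n // ltr_pdivrMr ?ltr0n //.
  rewrite -(nat1r n); apply/andP; split; apply/implyP => h.
    exact/h1/up.
  exact/h2/down.
have dp' X i (V : pred {ffun 'I_d0 -> bool}) :
    \sum_(v | V v) q X v <= 3 * (\sum_(v | V v) q (erase i X) v) + 3 * (k%:R * delta).
  have := decode_prob_group tt (marginal_threshold R n k) V eps0 delta0 dp
    (differ_erase d T k0 i X).
  move/le_trans; apply; rewrite -mulrDr ler_wpM2r //.
    by rewrite addr_ge0 ?mulr_ge0 // sumr_ge0 // => v _; exact: decode_prob_ge0.
  by rewrite (le_trans _ (ltW (expR1_lt3 R))) // ler_expR.
have q_ge0 X v : 0 <= q X v by exact: decode_prob_ge0.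
have q_total X : \sum_v q X v = 1 by exact: decode_prob_total.
have s0 : 0 < 216 * n%:R :> R by rewrite mulr_gt0.
have sd : (216 * n%:R) ^+ 2 = d0%:R :> R by rewrite /d0 natrX natrM.
have tau0 : 0 <= 1 / 36 :> R by lra.
(* With s = 216 n, division by n s leaves 216 / 18 = 12 on the left and at most 3 + 648 / 100 on the
   right. *)
have := fingerprint q_ge0 q_total n0 (ler0n R 3) tau0 s0 sd dp' acc'.
rewrite -sd; have n2 : 0 < n%:R ^+ 2 :> R by rewrite exprn_gt0.
have := ler_wpM2r (ltW n2) nkd.
lra.
Qed.

(** * Choice of the parameters *)

Lemma floor_half (R : realType) (r : R) : 1 <= r ->
  exists2 n : nat, (0 < n)%N & n%:R <= r <= 2 * n%:R.
Proof.
move=> r1; have r0 : 0 <= r by lra.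
have /andP[nr rn] := truncn_itv r0; set n := Num.truncn r in nr rn *.
have n0 : (0 < n)%N by rewrite -ltnS -(ltr_nat R); apply: le_lt_trans rn.
exists n => //; rewrite nr /=; have : 1 <= n%:R :> R by rewrite ler1n.
by rewrite -nat1r in rn; lra.
Qed.

Lemma ln_max2_ge_half (R : realType) (x : R) : 1 / 2 <= ln_max2 x.
Proof.
have half : 1 / 2 <= ln (2 : R).
  rewrite -lerN2 -lnV ?posrE //.
  have -> : 2^-1 = 1 + - 2^-1 :> R by field.
  by apply: le_trans (le_ln1Dx _) _; lra.
apply: le_trans half _; rewrite ler_ln ?posrE ?le_max ?lexx // lt_max ltr0n //.
Qed.

Section LowerBounds.
Variables (R : realType) (d : nat) (disp : measure_display).
Variables (Omega : measurableType disp) (P : probability Omega R).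
Variables (M : mechanism d P) (T : nat) (eps delta alpha : R).
Hypotheses (d_gt0 : (0 < d)%N) (T_ge6 : (6 <= T)%N).
Hypotheses (eps01 : 0 < eps <= 1) (delta_ge0 : 0 <= delta).
Hypothesis delta_small : delta <= 1 / 100 * (eps / T%:R).
Hypothesis dp : differentially_private eps delta T M.
Hypothesis acc : accurate alpha T M.

Let eps_gt0 : 0 < eps. Proof. by case/andP: eps01. Qed.
Let T_gt0 : 0 < T%:R :> R. Proof. by rewrite ltr0n; apply: leq_trans T_ge6. Qed.
Let iT_ge1 : 1 <= eps^-1. Proof. by rewrite invf_ge1 //; case/andP: eps01. Qed.

Lemma group_delta_small (k : nat) : k%:R <= eps^-1 ->
  T%:R * k%:R * delta <= 1 / 100.
Proof.
move=> ke; have : T%:R * k%:R * delta <= T%:R * eps^-1 * (1 / 100 * (eps / T%:R)).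
  by apply: ler_pM => //; rewrite ?mulr_ge0 // ler_wpM2l.
move/le_trans; apply; rewrite le_eqVlt; apply/orP; left; apply/eqP.
by field; rewrite !gt_eqF.
Qed.

(** The 24 collects a factor 6 for the blocks, 2 for rounding [k] and 2 from the error k / 2. *)
Lemma accuracy_ge_min : Num.min eps^-1 T%:R / 24 <= alpha.
Proof.
have T6 : 6 <= T%:R :> R by rewrite (ler_nat R 6).
have r1 : 1 <= Num.min eps^-1 (T%:R / 6) by rewrite le_min iT_ge1 /=; lra.
have [k k0 /andP[]] := floor_half r1; rewrite le_min => /andP[ke kT] rk.
have kT6 : (6 * k <= T)%N by rewrite -(ler_nat R) natrM; lra.
have keps : k%:R * eps <= 1 by rewrite -ler_pdivlMr // div1r.
have kdelta : k%:R * delta <= 1 / 50.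
  have k0R : 0 <= k%:R * delta by rewrite mulr_ge0.
  have := group_delta_small ke; rewrite -mulrA.
  have := ler_wpM2r k0R T6; lra.
have := accuracy_ge_block d_gt0 k0 kT6 (ltW eps_gt0) delta_ge0 keps kdelta dp acc.
have : Num.min eps^-1 T%:R <= 6 * Num.min eps^-1 (T%:R / 6).
  by rewrite !minEle; case: ifP; case: ifP; rewrite ?leNgt => /idP h1 /idP h2; lra.
by lra.
Qed.

Lemma pure_lower_bound : delta = 0 -> 1 / 384 * pure_bound eps d T <= alpha.
Proof.
move=> delta0; have dp0 : differentially_private eps 0 T M by rewrite -delta0.
pose r : R := Num.min d%:R (Num.sqrt (eps * T%:R)).
have sqrtE : Num.sqrt (T%:R / eps) = Num.sqrt (eps * T%:R) / eps.
  rewrite -{3}(gtr0_norm eps_gt0) -sqrtr_sqr -sqrtrV ?sqr_ge0 // -sqrtrM ?mulr_ge0 ?ltW //.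
  by congr Num.sqrt; field; rewrite gt_eqF.
have bT : pure_bound eps d T <= T%:R by rewrite /pure_bound ge_min lexx orbT.
have br : pure_bound eps d T <= r / eps.
  rewrite /pure_bound sqrtE ge_min; apply/orP; left.
  rewrite /r [Num.min d%:R _]minEle; case: ifP => _; rewrite ge_min lexx ?orbT //.
(* For r < 4, either d < 4 or eps T < 16, and the target is at most 16 min (1 / eps, T); this gives
   384 = 16 * 24. *)
have [r4|r4] := leP 4 r; last first.
  have : pure_bound eps d T <= 16 * Num.min eps^-1 T%:R.
    rewrite minEle; case: ifP => _; last by have := T_gt0; lra.
    move: r4; rewrite /r gt_min => /orP[d4|s4].
      apply: le_trans br _; rewrite ler_wpM2r ?invr_ge0 ?ltW //.
      by rewrite /r gt_min; apply/orP; left; lra.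
    apply: le_trans bT _; rewrite ler_pdivlMr // mulrC.
    have -> : 16 = 4 ^+ 2 :> R by ring.
    have e0 : 0 <= eps * T%:R by rewrite mulr_ge0 ?ltW.
    by rewrite -(sqr_sqrtr e0) lerXn2r ?nnegrE ?sqrtr_ge0 // ltW.
  by have := accuracy_ge_min; lra.
have r0 : 0 <= r by lra.
have /andP[nr rn] := truncn_itv r0; set d0 := Num.truncn r in nr rn *.
have d04 : (4 <= d0)%N by rewrite -ltnS -(ltr_nat R); apply: le_lt_trans rn.
have d04R : 4 <= d0%:R :> R by rewrite (ler_nat R 4).
have rd0 : r <= 2 * d0%:R by rewrite -nat1r in rn; lra.
(* Taking k close to d0 / (4 eps) needs d0 >= 4 to be positive; the stream then uses 2 d0 k <= d0^2
   / (2 eps) <= T records. *)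
have k1 : 1 <= d0%:R / 4 * eps^-1.
  by rewrite -[X in X <= _]mulr1 ler_pM //; lra.
have [k k0 /andP[kd dk]] := floor_half k1.
have dd0 : (0 < d0 <= d)%N.
  rewrite (leq_trans _ d04) //= -(ler_nat R); apply: le_trans nr _.
  by rewrite /r ge_min lexx.
have keps : k%:R * eps <= d0%:R / 4 by rewrite -ler_pdivlMr.
have r2 : r ^+ 2 <= eps * T%:R.
  have e0 : 0 <= eps * T%:R by rewrite mulr_ge0 ?ltW.
  by rewrite -(sqr_sqrtr e0) lerXn2r ?nnegrE ?sqrtr_ge0 // /r ge_min lexx orbT.
have kT : (2 * d0 * k <= T)%N.
  rewrite -(ler_nat R) !natrM -(ler_pM2r eps_gt0).
  have : d0%:R * d0%:R <= r ^+ 2 by rewrite expr2 ler_pM.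
  have := ler_wpM2l (ler0n R d0) keps.
  have : 0 < eps * T%:R by rewrite mulr_gt0.
  lra.
have := pure_accuracy_ge dd0 k0 kT (ltW eps_gt0) keps dp0 acc.
have : r / eps <= 2 * d0%:R * eps^-1 by rewrite ler_wpM2r // invr_ge0 ltW.
by lra.
Qed.

Lemma approx_lower_bound :
  1 / 24 / 46 ^+ 3 * approx_bound eps d T <= alpha.
Proof.
pose y : R := (eps * T%:R) `^ (1 / 3).
(* For n <= r and k <= 1 / eps, both size conditions hold: 216 n is at most the root of d, and 46^3
   >= 2 * 216^2 makes the stream fit into T. *)
pose r : R := Num.min (Num.sqrt d%:R / 216) (y / 46).
have e0 : 0 <= eps by exact: ltW.
have y0 : 0 <= y by exact: powR_ge0.
have y3 : y ^+ 3 = eps * T%:R.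
  rewrite -powR_mulrn // -powRrM (_ : 1 / 3 * 3%:R = 1) ?powRr1 //; last by field.
  by rewrite mulr_ge0 ?ltW.
have bT : approx_bound eps d T <= T%:R by rewrite /approx_bound ge_min lexx orbT.
have bd : approx_bound eps d T <= 2 * (Num.sqrt d%:R / eps).
  rewrite /approx_bound !ge_min; apply/orP; left; apply/orP; right.
  rewrite invfM [leLHS]mulrA [leLHS]mulrC ler_wpM2r ?mulr_ge0 ?sqrtr_ge0 ?invr_ge0 //.
  have h := ln_max2_ge_half (d%:R : R).
  by rewrite -[leRHS]invrK lef_pV2 ?posrE ?invr_gt0 //; lra.
have by_ : approx_bound eps d T <= 2 * (y / eps).
  rewrite /approx_bound !ge_min; apply/orP; left; apply/orP; left.
  have -> : y / eps = T%:R `^ (1 / 3) / eps `^ (2 / 3).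
    have e13 : eps `^ (1 / 3) != 0 by rewrite gt_eqF // powR_gt0.
    have e23 : eps `^ (2 / 3) != 0 by rewrite gt_eqF // powR_gt0.
    have eE : eps = eps `^ (1 / 3) * eps `^ (2 / 3).
      have s1 : 1 / 3 + 2 / 3 = 1 :> R by field.
      by rewrite -powRD ?s1 ?powRr1 // gt_eqF // implybT.
    rewrite {1}eE /y powRM //.
    by field; rewrite e13 e23.
  rewrite invfM [leLHS]mulrA [leLHS]mulrC ler_wpM2r ?mulr_ge0 ?powR_ge0 ?invr_ge0 ?powR_ge0 //.
  have h := ln_max2_ge_half (eps * T%:R); set L := ln_max2 _ in h *.
  have : 1 / 2 <= L `^ (2 / 3).
    apply: (@le_trans _ _ ((1 / 2) `^ (2 / 3))); first by apply: ger1_powR; lra.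
    by apply: ge0_ler_powR; rewrite ?nnegrE; lra.
  by move=> h'; rewrite -[leRHS]invrK lef_pV2 ?posrE ?invr_gt0 //; lra.
(* For r < 1, either the root of d is below 216 and the target is at most 432 / eps, or eps T <
   46^3. *)
have [r1|r1] := leP 1 r; last first.
  have : approx_bound eps d T <= 46 ^+ 3 * Num.min eps^-1 T%:R.
    rewrite minEle; case: ifP => _; last by have := T_gt0; lra.
    move: r1; rewrite /r gt_min => /orP[d1|y1].
      apply: le_trans bd _; rewrite mulrA ler_wpM2r ?invr_ge0 ?ltW //; lra.
    apply: le_trans bT _; rewrite ler_pdivlMr // mulrC -y3.
    by rewrite lerXn2r ?nnegrE //; lra.
  by have := accuracy_ge_min; lra.
have [n n0 /andP[]] := floor_half r1; rewrite le_min => /andP[nd ny] rn.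
have [k k0 /andP[ke ek]] := floor_half iT_ge1.
have keps : k%:R * eps <= 1 by rewrite -ler_pdivlMr // div1r.
have n1 : 1 <= n%:R :> R by rewrite ler1n.
have k1 : 1 <= k%:R :> R by rewrite ler1n.
have d0d : ((216 * n) ^ 2 <= d)%N.
  rewrite -(ler_nat R) natrX natrM -(sqr_sqrtr (ler0n R d)).
  by rewrite lerXn2r ?nnegrE ?sqrtr_ge0 ?mulr_ge0 //; lra.
have n3 : (46 * n%:R) ^+ 3 <= eps * T%:R.
  by rewrite -y3 lerXn2r ?nnegrE ?mulr_ge0 //; lra.
have kT : (2 * (216 * n) ^ 2 * (n * k) <= T)%N.
  rewrite -(ler_nat R) !natrM -(ler_pM2r eps_gt0).
  have n30 : 0 <= n%:R ^+ 3 :> R by rewrite exprn_ge0.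
  have := ler_wpM2l n30 keps.
  lra.
have nT : (n <= T)%N by apply: leq_trans kT; rewrite mulnCA leq_pmulr // !muln_gt0 n0 k0.
have nkd : n%:R * k%:R * delta <= 1 / 100.
  apply: le_trans (group_delta_small ke).
  by rewrite !ler_wpM2r // ler_nat.
have := approx_accuracy_ge n0 k0 d0d kT (ltW eps_gt0) delta_ge0 keps nkd dp acc.
have : r / eps <= 2 * n%:R * (2 * k%:R).
  by apply: ler_pM => //; [lra | rewrite invr_ge0].
have rE : 0 <= r / eps by apply: divr_ge0 => //; lra.
have : approx_bound eps d T <= 432 * (r / eps).
  move: rE; rewrite /r minEle; case: ifP => _ rE; first by lra.
  by move: by_ rE; rewrite mulrAC; lra.
lra.
Qed.

End LowerBounds.

(* The parameters of the asymptotic statement are functions of the stream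
   length T; the constant c depends on none of them. *)
Theorem theorem3p1 (R : realType) :
  exists2 c : R, 0 < c &
  forall (eps delta alpha : nat -> R) (d : nat -> nat),
    (forall T : nat, 0 < eps T <= 1) ->
    (forall T : nat, 0 <= delta T < 1) ->
    (forall T : nat, 0 <= alpha T) ->
    (forall T : nat, (0 < d T)%N) ->
    ((forall T : nat, 0 < delta T) ->
     delta =o_\oo (fun T : nat => eps T / T%:R) ->
     \forall T \near \oo,
       forall (disp : measure_display) (Omega : measurableType disp)
         (P : probability Omega R) (M : mechanism (d T) P),
         differentially_private (eps T) (delta T) T M ->
         accurate (alpha T) T M ->
         c * approx_bound (eps T) (d T) T <= alpha T)
    /\
    ((forall T : nat, delta T = 0) ->
     \forall T \near \oo,
       forall (disp : measure_display) (Omega : measurableType disp)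
         (P : probability Omega R) (M : mechanism (d T) P),
         differentially_private (eps T) (delta T) T M ->
         accurate (alpha T) T M ->
         c * pure_bound (eps T) (d T) T <= alpha T).
Proof.
(* The constant of the approximate case also serves the pure one, being below 1/384. *)
exists (1 / 24 / 46 ^+ 3); first by rewrite !divr_gt0 ?exprn_gt0.
move=> eps delta alpha d eps01 delta01 _ d0.
have delta0 T : 0 <= delta T by case/andP: (delta01 T).
have eT0 T : 0 <= eps T / T%:R by rewrite divr_ge0 // ltW //; case/andP: (eps01 T).
split=> [_ /eqoP/(_ (1 / 100))|deltaE].
  rewrite divr_gt0 // => /(_ isT) deltaT.
  near=> T => disp Omega P M dp acc.
  have T6 : (6 <= T)%N by near: T; exact: nbhs_infty_ge.
  apply: (approx_lower_bound (d0 T) T6 (eps01 T) (delta0 T) _ dp acc).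
  have : `|delta T| <= 1 / 100 * `|eps T / T%:R| by near: T.
  by rewrite !ger0_norm.
near=> T => disp Omega P M dp acc.
have T6 : (6 <= T)%N by near: T; exact: nbhs_infty_ge.
have small : delta T <= 1 / 100 * (eps T / T%:R).
  by rewrite deltaE mulr_ge0 // divr_ge0.
have := pure_lower_bound (d0 T) T6 (eps01 T) (delta0 T) small dp acc (deltaE T).
apply: le_trans; rewrite ler_wpM2r //; last by lra.
rewrite /pure_bound !le_min sqrtr_ge0 ler0n andbT /= divr_ge0 // ltW //.
by case/andP: (eps01 T).
Unshelve. all: by end_near. Qed.
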